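(* Let $K$ be a nonempty compact metric space and $\Phi$ a closed subspace of $\mathcal{C}(K)$ that separates points in $K$ and contains the constant functions. Let $\{f_i\}_{i\in I}\subset T\mathcal{C}^{>}(K,\Phi)$ be such that $$K_{\max}(I):=\bigcap_{i\in I}K_{\max}(f_i)\neq\emptyset.$$ Then there exists $\bar x\in\partial_\Phi(K)$ such that $f_i(\bar x)=\max_{x\in K}f_i(x)$ for every $i\in I$.
   Context: $\mathcal{C}(K)$ is the Banach space of continuous real-valued functions on $K$ with the sup-norm, and $w^*$ is the weak-star topology of $\Phi^*$. $K(\Phi):=\{Q\in\Phi^*:\ \|Q\|=\langle Q,\mathbf 1\rangle=1\}$ (with $\mathbf 1$ the constant function $1$), a convex $w^*$-compact subset of $\Phi^*$. $\delta^\Phi:K\to K(\Phi)$ is $\delta^\Phi(x)(\phi)=\phi(x)$. $T\mathcal{C}^{>}(K,\Phi)$ (usc convex-trace functions) is the set of functions $f:K\to\mathbb{R}$ of the form $f=F\circ\delta^\Phi$ with $F:K(\Phi)\to\mathbb{R}$ convex and $w^*$-upper semicontinuous. For $f:K\to\mathbb{R}$, $K_{\max}(f):=\{\bar x\in K:\ f(\bar x)=\max_{x\in K}f(x)\}$. For $x\in K$, $\mathcal{M}_x(\Phi)$ is the set of Borel probability measures $\mu$ on $K$ with $\phi(x)=\int_K\phi\,d\mu$ for all $\phi\in\Phi$. The $\Phi$-Choquet boundary is $\partial_\Phi(K):=\{x\in K:\ \mathcal{M}_x(\Phi)=\{\delta_x\}\}$, where $\delta_x$ is the Dirac measure at $x$;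 equivalently (a known fact), $\partial_\Phi(K)=\{x\in K:\ \delta^\Phi(x)\in\mathrm{Ext}(K(\Phi))\}$. *)

(* Defs.v *)
From HB Require Import structures.
From mathcomp Require Import all_boot all_order all_algebra.
From mathcomp Require Import interval_inference.
From mathcomp Require Import all_classical all_reals all_analysis.

Set Implicit Arguments.
Unset Strict Implicit.
Unset Printing Implicit Defensive.
Import Order.TTheory GRing.Theory Num.Theory.
Import numFieldNormedType.Exports.

Local Open Scope classical_set_scope.
Local Open Scope ring_scope.

HB.mixin Record isCompactSpace T & Topological T := {
  compactT : compact [set: T]
}.

(* Nonemptiness is given by a distinguished point, as the measurable types of
   the library require. *)
#[short(type="compactMetricType")]
HB.structure Definition CompactMetric (R : numDomainType) :=
  {K of Metric R K & isPointed K & isCompactSpace K}.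

Section continuous_functions.
Context {R : realType} (K : compactMetricType R).

Definition continuous_pred : {pred K -> R} :=
  mem [set f : K -> R | continuous f].

Record cfun := CFun {
  cfun_val :> K -> R;
  cfun_valP : cfun_val \in continuous_pred
}.

HB.instance Definition _ := [isSub for cfun_val].
HB.instance Definition _ := [Choice of cfun by <:].

Lemma cfun_continuous (f : cfun) : continuous f.
Proof. by case: f => f /= /set_mem. Qed.

Lemma continuous_submod_closed : submod_closed continuous_pred.
Proof.
split=> [|a f g /set_mem/= cf /set_mem/= cg]; apply/mem_set => /= x.
  exact: cst_continuous.
by apply: cvgD; [apply: cvgZr; exact: cf|exact: cg].
Qed.

HB.instance Definition _ :=
  GRing.isSubmodClosed.Build R (K -> R) continuous_pred
    continuous_submod_closed.
HB.instance Definition _ := [SubChoice_isSubLmodule of cfun by <:].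

Definition cfun_norm (f : cfun) : R := sup (range (fun x => `|f x|)).

Lemma cfun_norm_has_sup (f : cfun) : has_sup (range (fun x => `|f x|)).
Proof.
apply: compact_has_sup; first by exists `|f point|, point.
apply: continuous_compact (compactT : compact [set: K]).
apply: continuous_subspaceT => x; apply: continuous_comp.
  exact: cfun_continuous.
exact: norm_continuous.
Qed.

Lemma le_cfun_norm (f : cfun) x : `|f x| <= cfun_norm f.
Proof.
apply: ub_le_sup; last by exists x.
by case: (cfun_norm_has_sup f).
Qed.

Lemma cfun_norm_le (f : cfun) c : (forall x, `|f x| <= c) -> cfun_norm f <= c.
Proof.
move=> fc; apply: ge_sup; last by move=> _ [x _ <-].
by case: (cfun_norm_has_sup f).
Qed.

Lemma cfun_normD f g : cfun_norm (f + g) <= cfun_norm f + cfun_norm g.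
Proof.
apply: cfun_norm_le => x; rewrite (le_trans (ler_normD _ _))//.
by rewrite lerD// le_cfun_norm.
Qed.

Lemma cfun_normZ (a : R) f : cfun_norm (a *: f) = `|a| * cfun_norm f.
Proof.
apply/eqP; rewrite eq_le; apply/andP; split.
  apply: cfun_norm_le => x; rewrite [X in `|X|](_ : _ = a * f x)// normrM.
  by rewrite ler_wpM2l// le_cfun_norm.
have [->|a0] := eqVneq a 0.
  by rewrite normr0 mul0r (le_trans _ (le_cfun_norm _ point)).
rewrite -ler_pdivlMl ?normr_gt0//; apply: cfun_norm_le => x.
rewrite ler_pdivlMl ?normr_gt0// -normrM.
by apply: le_trans (le_cfun_norm _ x).
Qed.

Lemma cfun_norm0_eq0 f : cfun_norm f = 0 -> f = 0.
Proof.
move=> f0; apply/val_inj/funext => x /=; apply/eqP.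
by rewrite -normr_le0 -f0 le_cfun_norm.
Qed.

(* The norm topology is the topology of [cfun]: closed sets of [cfun] are
   closed for the sup-norm. *)
HB.instance Definition _ := Lmodule_isNormed.Build R cfun
  cfun_normD cfun_normZ cfun_norm0_eq0.

Lemma cst_continuous_pred (c : R) : cst c \in continuous_pred.
Proof. by apply/mem_set => x; exact: cst_continuous. Qed.

Definition cfun_cst (c : R) : cfun := CFun (cst_continuous_pred c).

End continuous_functions.

Section normed_subspace.
Context {R : realType} {V : normedModType R} (W : submodClosed V).

(* [submodClosed V] is the type of linear subspaces of [V], given by their
   membership predicate. *)
Definition normed_subspace := {x : V | x \in W}.

HB.instance Definition _ := SubType.on normed_subspace.
HB.instance Definition _ := Choice.on normed_subspace.
HB.instance Definition _ := [SubChoice_isSubLmodule of normed_subspace by <:].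

Definition normed_subspace_norm (x : normed_subspace) : R := `|\val x|.

Lemma normed_subspace_normD x y :
  normed_subspace_norm (x + y) <=
  normed_subspace_norm x + normed_subspace_norm y.
Proof. exact: ler_normD. Qed.

Lemma normed_subspace_normZ (a : R) x :
  normed_subspace_norm (a *: x) = `|a| * normed_subspace_norm x.
Proof. exact: normrZ. Qed.

Lemma normed_subspace_norm0_eq0 x : normed_subspace_norm x = 0 -> x = 0.
Proof. by move=> /normr0_eq0 x0; exact/val_inj. Qed.

HB.instance Definition _ := Lmodule_isNormed.Build R normed_subspace
  normed_subspace_normD normed_subspace_normZ normed_subspace_norm0_eq0.

End normed_subspace.

Section dual.
Context {R : realType} {V : normedModType R}.

(* As a set of points of [{ptws V -> R}] it carries the weak-star topology. *)
Definition dual : set {ptws V -> R} :=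
  [set Q | linear (Q : V -> R^o) /\ continuous (Q : V -> R)].

Definition dual_norm (Q : V -> R) : R :=
  sup [set `|Q v| | v in [set v : V | `|v| <= 1]].

End dual.

Lemma linear_le_norm_continuous {R : realType} {V : normedModType R}
    (Q : V -> R) : linear (Q : V -> R^o) -> (forall v, `|Q v| <= `|v|) ->
  continuous Q.
Proof.
move=> linQ Qle v; apply/cvgrPdist_le => e e0; near=> w.
have -> : Q v - Q w = Q (v - w).
  by rewrite [v - w]addrC -(scaleN1r w) linQ scaleN1r addrC.
rewrite (le_trans (Qle _))//.
Unshelve. all: by end_near. Qed.

Definition upper_semicontinuous {R : realType} {X : topologicalType}
  (f : X -> R) := lower_semicontinuous (fun x => (- f x)%:E).

Section choquet.
Context {R : realType} {K : compactMetricType R}.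
Implicit Types (Phi : submodClosed (cfun K)) (x : K).

Definition separates_points Phi :=
  forall x y : K, x != y -> exists2 phi, phi \in Phi & phi x != phi y.

Definition contains_constants Phi := forall c : R, cfun_cst K c \in Phi.

Definition state_space Phi : set {ptws normed_subspace Phi -> R} :=
  [set Q | [/\ dual Q, dual_norm Q = 1 &
    exists2 one : normed_subspace Phi, \val one = cfun_cst K 1 & Q one = 1]].
Arguments state_space : clear implicits.

Definition delta Phi x : {ptws normed_subspace Phi -> R} :=
  fun phi => \val phi x.
Arguments delta : clear implicits.

Lemma delta_state_space Phi x :
  contains_constants Phi -> state_space Phi (delta Phi x).
Proof.
move=> Phi1.
have delta_le phi : `|delta Phi x phi| <= `|phi| by exact: le_cfun_norm.
have linD : linear (delta Phi x : _ -> R^o).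
  by move=> a u v; rewrite /delta linearP.
split.
- by split=> //; exact: linear_le_norm_continuous.
- apply/eqP; rewrite eq_le; apply/andP; split.
    apply: ge_sup; first by exists `|delta Phi x 0|, 0 => //=; rewrite normr0.
    by move=> _ [phi /= phi1 <-]; exact: le_trans (delta_le _) phi1.
  apply: ub_le_sup.
    by exists 1 => _ [phi /= phi1 <-]; exact: le_trans (delta_le _) phi1.
  exists (exist _ (cfun_cst K 1) (Phi1 1)); last exact: normr1.
  by apply: cfun_norm_le => y; rewrite /= normr1.
- by exists (exist _ (cfun_cst K 1) (Phi1 1)).
Qed.

(* Only the restriction of [F] to [state_space Phi] matters, since that set
   contains the range of [delta Phi]; as a type, [state_space Phi] carries the
   topology induced by the weak-star topology. *)
Definition usc_convex_trace Phi : set (K -> R) :=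
  [set f | exists F : {ptws normed_subspace Phi -> R} -> R,
    [/\ convex_function (E := normed_subspace Phi -> R) (state_space Phi) F,
        upper_semicontinuous (fun Q : state_space Phi => F (\val Q)) &
        f = F \o delta Phi]].

Definition argmax (f : K -> R) : set K := [set x | forall y, f y <= f x].

Definition borel : measurableType _ := g_sigma_algebraType (@open K).

Definition representing_measures Phi x : set (probability borel R) :=
  [set mu : probability borel R | forall phi, phi \in Phi ->
    (\int[mu]_(y in [set: borel]) (phi (y : K))%:E = (phi x)%:E)%E].

(* Measures of the library are functions on all sets, constrained only on the
   measurable ones, hence the equality of measures on measurable sets. *)
Definition choquet_boundary Phi : set K :=
  [set x | forall mu : probability borel R, representing_measures Phi x mu <->
    (forall A : set borel, measurable A -> mu A = \d_(x : borel) A)].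

End choquet.
Arguments borel {R} K.
Arguments state_space {R K} Phi.
Arguments delta {R K} Phi x.

(* Main.v *)
Require Import Defs.
From HB Require Import structures.
From mathcomp Require Import all_boot all_order all_algebra.
From mathcomp Require Import all_classical all_reals all_analysis.
From mathcomp Require Import ring lra.

(** The theorem is a Bauer-type maximum principle, proved on [K] itself by
    following closed sets that representing measures cannot leave.  Call a
    closed set [E] extremal when every measure that represents a point of [E]
    is carried by [E].

    The heart of the proof ([face_extremal]) is that the points of an extremal
    set [E] at which a trace [f = F \o delta] is maximal over [E] form an
    extremal set again.  Let [mu] represent such a point [x], and suppose that
    [mu] charges every neighbourhood of some [y] in [E] with [f y < f x].  Cut
    [mu] into its restriction to a small neighbourhood [U] of [y] and the rest.
    The normalized integral over [U] is a state close to [delta y], so upper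
    semicontinuity puts the value of [F] there strictly below [f x]; the
    normalized integral over the rest is a state at which [F] is at most [f x],
    up to any [e > 0].  Convexity bounds [f x] by the average of the two values,
    which is smaller than [f x].  The bound on the rest ([cond_mean_le]) comes
    from the same two ingredients and compactness: [C |-> mu C * F (mean of C)]
    is subadditive ([cond_mean_split]), and it is at most [c * mu C] for the
    subsets [C] of a small neighbourhood of each point ([cond_mean_le_near]).

    Arbitrary intersections of extremal sets are extremal, because the topology
    of [K] has a countable base ([open_null_bigcup]).  In particular the set of
    common maximizers is extremal, and by Zorn's lemma and compactness it
    contains a minimal nonempty extremal set [E].  Functions of [Phi] are traces
    of evaluations, so the maximizers of each of them over [E] form an extremal
    subset, hence all of [E]: every function of [Phi] is constant on [E].  As
    [Phi] separates points, [E] is a singleton, and a point whose singleton is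
    extremal belongs to the Choquet boundary. *)

Set Implicit Arguments.
Unset Strict Implicit.
Unset Printing Implicit Defensive.

Import Order.TTheory GRing.Theory Num.Theory.
Import numFieldNormedType.Exports.
Local Open Scope classical_set_scope.
Local Open Scope ring_scope.

(** * Compactness and Borel measures *)

(** Turns a finite subcover into an induction principle: a property of sets
    that is local, hereditary and stable under binary unions holds globally. *)
Lemma compact_set_ind (T : topologicalType) (P : set T -> Prop) :
  compact [set: T] -> P set0 ->
  (forall A B, P A -> P B -> P (A `|` B)) ->
  (forall A B, A `<=` B -> P B -> P A) ->
  (forall x : T, exists2 U, nbhs x U & P U) -> P [set: T].
Proof.
move=> cT P0 PU Psub Ploc; apply: contrapT => nPT.
pose F : set_system T := [set A | P (~` A)].
have FF : ProperFilter F.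
  split; first by rewrite /F/= setC0.
  split.
  - by rewrite /F/= setCT.
  - by move=> A B PA PB; rewrite /F/= setCI; exact: PU.
  - by move=> A B AB; apply: Psub; exact: subsetC.
(* A cluster point of the sets whose complement satisfies [P]. *)
have [x [_ clx]] : [set: T] `&` cluster F !=set0.
  by apply: cT; rewrite /F/= setCT.
have [U xU PUU] := Ploc x.
have [|y [nUy Uy]] := clx (~` U) U _ xU; first by rewrite /F/= setCK.
exact: nUy Uy.
Qed.

Section borel.
Context {R : realType} {K : compactMetricType R}.
Implicit Types (mu : probability (borel K) R).

Lemma open_borel (U : set K) : open U -> measurable (U : set (borel K)).
Proof. by move=> oU; exact: sub_sigma_algebra. Qed.

(** The union may be uncountable: it is also the union of the null members of a
    countable base. *)
Lemma open_null_bigcup mu (F : set (set K)) :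
  (forall U, F U -> open U /\ mu U = 0%E) -> mu (\bigcup_(U in F) U) = 0%E.
Proof.
move=> F0.
have oF : open (\bigcup_(U in F) U) by apply: bigcup_open => U /F0[].
apply/negligibleP; first exact: open_borel.
have [B cB [Bo Bb]] := @compact_second_countable R K compactT.
have [B0|[g]] := (elimT pfcard_geP) cB.
  suff -> : \bigcup_(U in F) U = set0 by exact: negligible_set0.
  apply/seteqP; split=> // x [U /F0[oU _] Ux].
  by have [V []] := Bb x U (open_nbhs_nbhs (conj oU Ux)); rewrite B0.
pose N n := [set x | g n x /\ mu (g n) = 0%E].
have subN : \bigcup_(U in F) U `<=` \bigcup_n N n.
  move=> x [U FU Ux]; have [oU U0] := F0 _ FU.
  have [V [BV Vx] VU] := Bb x U (open_nbhs_nbhs (conj oU Ux)).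
  have [n _ gn] := @surj _ _ _ _ g _ BV.
  exists n; rewrite // /N/= gn; split=> //.
  have mV : measurable (V : set (borel K)) by exact: open_borel (Bo _ BV).
  exact: (subset_measure0 mV (open_borel oU) VU U0).
refine (@negligibleS _ _ _ mu _ _ subN _); apply: negligible_bigcup => n.
have Bg : B (g n) by exact: (@funS _ _ _ _ g).
have mg : measurable (g n : set (borel K)) by exact: open_borel (Bo _ Bg).
have [g0|g0] := eqVneq (mu (g n)) 0%E.
  have Ng : N n `<=` g n by move=> x [].
  by refine (@negligibleS _ _ _ mu _ _ Ng _); exact/negligibleP.
suff -> : N n = set0 by exact: negligible_set0.
by apply/seteqP; split=> // x [_ /eqP]; rewrite (negbTE g0).
Qed.

Lemma cfun_measurable (phi : cfun K) (D : set (borel K)) :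
  measurable D -> measurable_fun D (phi : borel K -> R).
Proof.
move=> mD.
apply: (measurability _ (measurable_realfun.RGenOpens.measurableE R)).
move=> _ [_ [a [b ->]] <-].
apply: measurableI => //; apply: open_borel.
by apply: open_comp; [move=> x _; exact: cfun_continuous|exact: interval_open].
Qed.

Lemma cfun_integrable mu (phi : cfun K) (D : set (borel K)) :
  measurable D -> mu.-integrable D (EFin \o (phi : borel K -> R)).
Proof.
move=> mD; apply: measurable_bounded_integrable => //.
- by rewrite (le_lt_trans (probability_le1 mu mD))// ltry.
- exact: cfun_measurable.
exists `|phi|; split; first exact: num_real.
by move=> x ltx y _ /=; rewrite (le_trans (le_cfun_norm _ _))// ltW.
Qed.

End borel.

(** * Normalized integrals as states *)

Section conditional_mean.
Context {R : realType} {K : compactMetricType R} (Phi : submodClosed (cfun K)).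
Context (Phi_cst : contains_constants Phi).
Local Notation V := (normed_subspace Phi).

Lemma state_spaceP (Q : {ptws V -> R}) : linear (Q : V -> R^o) ->
  (forall phi, `|Q phi| <= `|phi|) ->
  Q (exist _ (cfun_cst K 1) (Phi_cst 1)) = 1 -> state_space Phi Q.
Proof.
move=> linQ Qle Q1; split.
- by split=> //; exact: linear_le_norm_continuous.
- apply/eqP; rewrite eq_le; apply/andP; split.
    apply: ge_sup; first by exists `|Q 0|, 0 => //=; rewrite normr0.
    by move=> _ [phi /= phi1 <-]; exact: le_trans (Qle _) phi1.
  apply: ub_le_sup.
    by exists 1 => _ [phi /= phi1 <-]; exact: le_trans (Qle _) phi1.
  exists (exist _ (cfun_cst K 1) (Phi_cst 1)); last by rewrite Q1 normr1.
  by apply: cfun_norm_le => y; rewrite /= normr1.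
- by exists (exist _ (cfun_cst K 1) (Phi_cst 1)).
Qed.

Context (mu : probability (borel K) R).
Implicit Types (C D : set (borel K)) (phi : V).

Definition mass C : R := fine (mu C).

(** The barycentre of the measure [mu] conditioned on [C], a state as soon as
    [C] has positive mass. *)
Definition cond_mean C : {ptws V -> R} :=
  fun phi => (mass C)^-1 * \int[mu]_(y in C) (\val phi (y : K)).

Lemma mass_ge0 C : 0 <= mass C. Proof. exact: fine_ge0. Qed.

Lemma massE C : measurable C -> mu C = (mass C)%:E.
Proof. by move=> mC; rewrite fineK// fin_num_measure. Qed.

Lemma mass_split C D : measurable C -> measurable D ->
  mass C = mass (C `&` D) + mass (C `\` D).
Proof.
move=> mC mD; have mCD := measurableI _ _ mC mD; have mCD' := measurableD mC mD.
apply: EFin_inj; rewrite EFinD -!massE// addeC.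
exact: measureDI.
Qed.

Lemma Rintegral_split C D phi : measurable C -> measurable D ->
  \int[mu]_(y in C) (\val phi (y : K)) =
  \int[mu]_(y in C `&` D) (\val phi (y : K)) +
  \int[mu]_(y in C `\` D) (\val phi (y : K)).
Proof.
move=> mC mD; have mCD := measurableI _ _ mC mD; have mCD' := measurableD mC mD.
rewrite -Rintegral_setU ?setUIDK//; first exact: cfun_integrable.
by apply/disj_setPS => z [[_ Dz] [_ nDz]]; exact: nDz.
Qed.

(** With [c = 0] this bounds integrals by the norm; with [c] a value of [phi] it
    localizes conditional means. *)
Lemma Rintegral_dist_le C phi (c e : R) : measurable C ->
  (forall y : K, C y -> `|\val phi y - c| <= e) ->
  `|\int[mu]_(y in C) (\val phi (y : K)) - c * mass C| <= e * mass C.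
Proof.
move=> mC phice; have intphi := cfun_integrable mu (\val phi) mC.
have intcst k := finite_measure_integrable_cst mu k mC.
rewrite -!Rintegral_cst// -RintegralB//; last exact: intcst.
have intB :
    mu.-integrable C (EFin \o (fun y : borel K => \val phi (y : K) - c)).
  exact (integrableB mC intphi (intcst c)).
apply: le_trans (le_normr_Rintegral mC _) _ => //.
apply: le_Rintegral => //; last exact: intcst.
exact: integrable_norm intB.
Qed.

Lemma Rintegral_mass0 C phi : measurable C -> mass C = 0 ->
  \int[mu]_(y in C) (\val phi (y : K)) = 0.
Proof.
move=> mC C0; apply/eqP; rewrite -normr_le0.
have := @Rintegral_dist_le C phi 0 `|phi| mC.
rewrite C0 !mulr0 subr0; apply => y _; rewrite subr0.
exact: le_cfun_norm.
Qed.

Lemma cond_mean_state C : measurable C -> 0 < mass C ->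
  state_space Phi (cond_mean C).
Proof.
move=> mC C0; have C0' : mass C != 0 by rewrite gt_eqF.
apply: state_spaceP.
- move=> a u v; rewrite /cond_mean.
  have iu := cfun_integrable mu (\val u) mC.
  have iv := cfun_integrable mu (\val v) mC.
  have -> : \int[mu]_(y in C) (\val (a *: u + v) (y : K)) =
      \int[mu]_(y in C) (a * \val u (y : K) + \val v (y : K)).
    by apply: eq_Rintegral => y _; rewrite linearP.
  rewrite RintegralD//; last exact: (integrableZl mC a iu).
  by rewrite RintegralZl// mulrDr mulrCA.
- move=> phi; rewrite normrM ger0_norm ?invr_ge0 ?mass_ge0//.
  rewrite ler_pdivrMl// mulrC.
  have := @Rintegral_dist_le C phi 0 `|phi| mC.
  by rewrite mul0r subr0; apply => y _; rewrite subr0; exact: le_cfun_norm.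
- by rewrite /cond_mean /= Rintegral_cst// mul1r mulVf.
Qed.

(** Coordinatewise, the mean of [phi] over a set where [phi] varies by at most
    [e] is within [e] of the values of [phi] there. *)
Lemma cond_mean_near (y : K) (W : set {ptws V -> R}) : nbhs (delta Phi y) W ->
  exists2 U : set K, open U /\ U y &
    forall C, measurable C -> C `<=` U -> 0 < mass C -> W (cond_mean C).
Proof.
move=> yW.
(* The filter of conditional means over ever smaller sets around [y]. *)
pose F := filter_from (nbhs y) (fun U => [set cond_mean C | C in
  [set C : set (borel K) | [/\ measurable C, C `<=` U & 0 < mass C]]]).
have FF : Filter F.
  apply: filter_from_filter; first by exists setT; exact: filterT.
  move=> A B yA yB; exists (A `&` B); first exact: filterI.
  move=> _ [C [mC CAB C0] <-].
  by split; exists C => //; split=> // z /CAB[].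
suff /(_ _ yW) [U yU UW] : F --> (delta Phi y : {ptws V -> R}).
  move: yU; rewrite nbhsE => -[A oA AU]; exists A => // C mC CA C0.
  by apply: UW; exists C => //; split=> // z /CA/AU.
apply/pointwise_cvgP => phi; apply/cvgrPdist_le => e e0.
have phiy : \forall z \near y, `|\val phi z - \val phi y| <= e.
  have /cvgrPdist_le/(_ _ e0) := @cfun_continuous R K (\val phi) y.
  by apply: filterS => z; rewrite distrC.
exists [set z | `|\val phi z - \val phi y| <= e] => //.
move=> _ [C [mC CU C0] <-] /=.
have := Rintegral_dist_le mC CU.
rewrite distrC -ler_pdivrMr//; apply: le_trans.
rewrite -[X in _ <= _ / X]gtr0_norm// -normf_div mulrBl mulfK ?gt_eqF//.
by rewrite /cond_mean mulrC.
Qed.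

(** Convexity, cleared of denominators: in this form sets of mass zero need no
    separate treatment, although their conditional mean is not a state. *)
Lemma cond_mean_split (F : {ptws V -> R} -> R) C D :
  convex_function (E := V -> R) (state_space Phi) F ->
  measurable C -> measurable D ->
  mass C * F (cond_mean C) <=
  mass (C `&` D) * F (cond_mean (C `&` D)) +
  mass (C `\` D) * F (cond_mean (C `\` D)).
Proof.
move=> cF mC mD; have mI := measurableI _ _ mC mD; have mB := measurableD mC mD.
have massC := mass_split mC mD.
have [I0|I0] := eqVneq (mass (C `&` D)) 0.
  suff -> : cond_mean C = cond_mean (C `\` D) by rewrite massC I0 mul0r !add0r.
  apply/funext => phi; rewrite /cond_mean (Rintegral_split _ mC mD).
  by rewrite (Rintegral_mass0 _ mI I0) massC I0 !add0r.
have [B0|B0] := eqVneq (mass (C `\` D)) 0.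
  suff -> : cond_mean C = cond_mean (C `&` D) by rewrite massC B0 mul0r !addr0.
  apply/funext => phi; rewrite /cond_mean (Rintegral_split _ mC mD).
  by rewrite (Rintegral_mass0 _ mB B0) massC B0 !addr0.
have {}I0 : 0 < mass (C `&` D) by rewrite lt_neqAle eq_sym I0 mass_ge0.
have {}B0 : 0 < mass (C `\` D) by rewrite lt_neqAle eq_sym B0 mass_ge0.
have C0 : 0 < mass C by rewrite massC addr_gt0.
pose t := mass (C `&` D) / mass C.
have t0 : 0 <= t by rewrite divr_ge0// ltW.
have onemt : 1 - t = mass (C `\` D) / mass C.
  by rewrite /t massC; field; rewrite -massC gt_eqF.
have t1 : t <= 1 by rewrite -subr_ge0 onemt divr_ge0// ltW.
have meanC : t *: (cond_mean (C `&` D) : V -> R) +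
    (1 - t) *: (cond_mean (C `\` D) : V -> R) = cond_mean C.
  apply/funext => phi; rewrite onemt /t /cond_mean (Rintegral_split _ mC mD).
  rewrite [LHS](_ : _ = mass (C `&` D) / mass C * ((mass (C `&` D))^-1 *
    \int[mu]_(y in C `&` D) \val phi (y : K)) + mass (C `\` D) / mass C *
    ((mass (C `\` D))^-1 * \int[mu]_(y in C `\` D) \val phi (y : K)))//.
  by field; rewrite !gt_eqF.
have Fle : F (t *: (cond_mean (C `&` D) : V -> R) +
    (1 - t) *: (cond_mean (C `\` D) : V -> R)) <=
    t * F (cond_mean (C `&` D)) + (1 - t) * F (cond_mean (C `\` D)).
  exact: (cF (Itv01 t0 t1) _ _ (mem_set (cond_mean_state mI I0))
    (mem_set (cond_mean_state mB B0))).
move: Fle; rewrite meanC onemt /t -(ler_pM2l C0) => /le_trans; apply.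
by rewrite le_eqVlt; apply/orP; left; apply/eqP; field; rewrite gt_eqF.
Qed.

End conditional_mean.
Arguments cond_mean {R K} Phi mu C.

(** * Traces of upper semicontinuous functions on states *)

Section trace.
Context {R : realType} {K : compactMetricType R} (Phi : submodClosed (cfun K)).
Context (Phi_cst : contains_constants Phi).
Local Notation V := (normed_subspace Phi).

Lemma usc_near (F : {ptws V -> R} -> R) (y : K) (c : R) :
  upper_semicontinuous (fun Q : state_space Phi => F (\val Q)) ->
  F (delta Phi y) < c ->
  exists2 W, nbhs (delta Phi y) W &
    forall Q, state_space Phi Q -> W Q -> F Q < c.
Proof.
move=> uF Fc.
pose Qy : state_space Phi :=
  SigSub (mem_set (delta_state_space y Phi_cst)).
have [|W [_ [[B oB <-] By BW]] WF] := uF Qy (- c).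
  by rewrite lte_fin ltrN2.
exists B; first exact: open_nbhs_nbhs.
move=> Q SQ BQ; pose Q' : state_space Phi := SigSub (mem_set SQ).
have := WF Q' (BW Q' BQ).
by rewrite lte_fin ltrN2.
Qed.

Lemma delta_continuous : continuous (delta Phi).
Proof.
by move=> y; apply/pointwise_cvgP => phi; exact: cfun_continuous.
Qed.

Lemma trace_open (f : K -> R) (c : R) :
  usc_convex_trace Phi f -> open [set y | f y < c].
Proof.
move=> [F [_ uF ->]]; rewrite openE => y /= yc.
have [W yW WF] := usc_near uF yc.
have : \forall z \near y, W (delta Phi z) by exact: delta_continuous yW.
by apply: filterS => z; apply: WF; exact: delta_state_space.
Qed.

Lemma eval_usc_convex_trace (phi : cfun K) :
  phi \in Phi -> usc_convex_trace Phi phi.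
Proof.
move=> Phiphi; pose p : V := exist _ phi Phiphi.
exists (fun Q => Q p); split => //.
- by move=> t Q Q' _ _.
- move=> Q a; rewrite lte_fin => aQ.
  have evp : (fun Q' : {ptws V -> R} => Q' p) @ \val Q -->
      (\val Q : {ptws V -> R}) p.
    exact: (@proj_continuous _ _ p (\val Q)).
  have Qpa : (\val Q : {ptws V -> R}) p < - a by rewrite ltrNr.
  have /= := @cvgr_lt _ _ _ (nbhs_filter _) _ _ evp _ Qpa.
  rewrite near_simpl nbhsE => -[B [oB BQ] Ba].
  exists (\val @^-1` B); last by move=> Q' /Ba; rewrite lte_fin ltrNr.
  exists (\val @^-1` B). split.
  - exact (ex_intro2 _ _ B oB erefl).
  - exact BQ.
  - by [].
Qed.

Section representing.
Context (mu : probability (borel K) R) (F : {ptws V -> R} -> R).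
Context (cF : convex_function (E := V -> R) (state_space Phi) F).
Context (uF : upper_semicontinuous (fun Q : state_space Phi => F (\val Q))).
Implicit Types (C : set (borel K)).
Local Notation G C := (mass mu C * F (cond_mean Phi mu C)).

Lemma cond_mean_le_near (y : K) c : F (delta Phi y) < c ->
  exists2 U : set K, open U /\ U y &
    forall C, measurable C -> C `<=` U -> G C <= c * mass mu C.
Proof.
move=> Fc; have [W yW WF] := usc_near uF Fc.
have [U yU UW] := cond_mean_near mu yW; exists U => // C mC CU.
have := mass_ge0 mu C; rewrite le_eqVlt => /predU1P[<-|C0].
  by rewrite mul0r mulr0.
rewrite mulrC ler_pM2r// ltW// WF//; last exact: UW.
exact: cond_mean_state.
Qed.

(** A Jensen-type bound without any integral of [F]: subadditivity reduces it to
    small sets, where either the conditional mean is close to some [delta y]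
    with [y] in [E], or the mass vanishes. *)
Lemma cond_mean_le (E : set K) c : closed E -> mass mu (~` E) = 0 ->
  (forall y, E y -> F (delta Phi y) < c) ->
  forall C, measurable C -> G C <= c * mass mu C.
Proof.
move=> cE E0 Ec.
(* [B] itself may fail to be measurable, so the bound is stated on a
   measurable superset. *)
pose P (B : set K) := exists B' : set (borel K), [/\ measurable B', B `<=` B' &
  forall C, measurable C -> C `<=` B' -> G C <= c * mass mu C].
suff [T [mT TT Tc]] : P [set: K] by move=> C mC; apply: Tc => // y _; exact: TT.
apply: compact_set_ind compactT _ _ _ _.
- exists set0; split=> // C _; rewrite subset0 => ->.
  by rewrite /mass measure0 mul0r mulr0.
- move=> A B [A' [mA AA' A'c]] [B' [mB BB' B'c]]; exists (A' `|` B').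
  split; [exact: measurableU|exact: setUSS|] => C mC CAB.
  apply: le_trans (cond_mean_split Phi_cst mu cF mC mA) _.
  rewrite (mass_split mu mC mA) mulrDr lerD//.
    by apply: A'c => [|z []//]; exact: measurableI.
  by apply: B'c => [|z [/CAB[]]//]; exact: measurableD.
- by move=> A B AB [B' [mB BB' B'c]]; exists B'; split=> // z /AB/BB'.
- move=> y; have [Ey|Ey] := pselect (E y).
    have [U [oU Uy] Uc] := cond_mean_le_near (Ec _ Ey).
    exists U; first exact: open_nbhs_nbhs.
    by exists U; split=> //; exact: open_borel.
  have oE : open (~` E) by exact: closed_openC.
  exists (~` E); first exact: (open_nbhs_nbhs (conj oE Ey)).
  exists (~` E); split=> //; first exact: open_borel.
  move=> C mC CE; suff -> : mass mu C = 0 by rewrite mul0r mulr0.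
  have mE := open_borel oE.
  rewrite /mass (subset_measure0 mC mE CE)//.
  by have := massE mu mE; rewrite E0.
Qed.

End representing.

(** * Extremal sets *)

(** The analogue on [K] of a closed face of the state space. *)
Definition extremal (E : set K) := closed E /\
  forall x mu, E x -> representing_measures Phi x mu -> mu (~` E) = 0%E.

Definition face (E : set K) (f : K -> R) :=
  [set x | E x /\ forall y, E y -> f y <= f x].

Lemma cond_mean_setT (mu : probability (borel K) R) x :
  representing_measures Phi x mu -> cond_mean Phi mu setT = delta Phi x.
Proof.
move=> mux; apply/funext => phi; rewrite /cond_mean /mass probability_setT.
by rewrite invr1 mul1r /Rintegral mux//; exact: (valP phi).
Qed.

(** A measure representing a maximizer [x] that charges every neighbourhood of a
    point [y] with a smaller value would, after splitting off a small
    neighbourhood of [y], contradict the convexity of [F]. *)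
Lemma face_extremal E f : extremal E -> usc_convex_trace Phi f ->
  extremal (face E f).
Proof.
move=> [cE Enull] tf.
have -> : face E f = E `&` \bigcap_(z in E) ~` [set y | f y < f z].
  apply/seteqP; split=> [x [Ex xmax]|x [Ex xmax]]; split=> // z Ez.
    by apply/negP; rewrite -leNgt; exact: xmax.
  by rewrite leNgt; apply/negP; exact: xmax.
have cB : closed (\bigcap_(z in E) ~` [set y | f y < f z]).
  by apply: closed_bigI => z _; apply: open_closedC; exact: trace_open.
split; first exact: closedI.
move=> x mu [Ex xmax] mux; have [F [cF uF fF]] := tf.
(* It suffices to cover the complement by open null sets. *)
pose N := [set U : set K | open U /\ mu U = 0%E].
have N0 : mu (\bigcup_(U in N) U) = 0%E by apply: open_null_bigcup => U [].
rewrite setCI.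
have mE : mu (~` E) = 0%E := Enull _ _ Ex mux.
set B := \bigcap_(z in E) _.
have oEB : open (~` E `|` ~` B).
  by apply: openU; exact: closed_openC.
suff EN : (~` E `|` ~` B) `<=` \bigcup_(U in N) U.
  have oN : open (\bigcup_(U in N) U) by apply: bigcup_open => U [].
  exact: (subset_measure0 (open_borel oEB) (open_borel oN) EN N0).
move=> y [nEy|ymax].
  by exists (~` E) => //; split=> //; exact: closed_openC.
have {ymax} fyx : f y < f x.
  move: ymax; rewrite /B setC_bigcap => -[z Ez]; rewrite setCK /=.
  move=> /lt_le_trans.
  by apply; rewrite leNgt; apply/negP; exact: xmax.
(* Any [c] strictly between [f y] and [f x] will do. *)
pose c := (f y + f x) / 2.
have yc : F (delta Phi y) < c by move: fyx; rewrite /c fF/=; lra.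
have cx : c < f x by rewrite /c; lra.
have [A [oA Ay] Ac] := cond_mean_le_near mu uF yc.
exists A => //; split=> //.
have mO := open_borel oA.
rewrite massE//; congr EFin; apply/eqP; rewrite eq_le mass_ge0 andbT.
rewrite -(pmulr_rle0 _ (_ : 0 < f x - c)) ?subr_gt0//.
apply/ler_addgt0Pr => e e0; rewrite add0r.
have massT : mass mu setT = 1 by rewrite /mass probability_setT.
have massO := mass_split mu measurableT mO.
have := cond_mean_split Phi_cst mu cF measurableT mO.
rewrite massT mul1r setTI (cond_mean_setT mux) => fx.
have GO : mass mu A * F (cond_mean Phi mu A) <= c * mass mu A by exact: Ac.
have GnO : mass mu (setT `\` A) * F (cond_mean Phi mu (setT `\` A)) <=
    (f x + e) * mass mu (setT `\` A).
  apply: (@cond_mean_le mu F cF uF E) => //.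
  - by rewrite /mass mE.
  - move=> z Ez; have : f z <= f x by rewrite leNgt; apply/negP; exact: xmax.
    by rewrite fF /= => /le_lt_trans; apply; rewrite ltrDl.
  - exact: measurableD.
have := mass_ge0 mu A; have := mass_ge0 mu (setT `\` A).
move: massO; rewrite massT setTI => massO.
have Ffx : F (delta Phi x) = f x by rewrite fF.
rewrite Ffx in fx.
(* Convexity and the two bounds give [f x <= c * m + (f x + e) * (1 - m)] with
   [m] the mass of [A], whence [(f x - c) * m <= e]. *)
nra.
Qed.

Lemma extremal_setT : extremal [set: K].
Proof. by split=> [|x mu _ _]; [exact: closedT|rewrite setCT measure0]. Qed.

Lemma extremal_bigcap (J : Type) (D : set J) (E : J -> set K) :
  (forall j, D j -> extremal (E j)) -> extremal (\bigcap_(j in D) E j).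
Proof.
move=> extE; split; first by apply: closed_bigI => j /extE[].
move=> x mu Ex mux; rewrite setC_bigcap.
rewrite -(bigcup_image D (fun j => ~` E j) id); apply: open_null_bigcup.
move=> _ [j Dj <-]; have [cE Enull] := extE _ Dj.
by split; [exact: closed_openC|exact: Enull (Ex _ Dj) mux].
Qed.

(** Zorn's lemma on the complements within [E0]; compactness keeps the
    intersection of a chain nonempty. *)
Lemma extremal_minimal (E0 : set K) : extremal E0 -> E0 !=set0 ->
  exists E, [/\ extremal E, E !=set0, E `<=` E0 &
    forall E', extremal E' -> E' !=set0 -> E' `<=` E -> E' = E].
Proof.
move=> extE0 E00.
pose P := [set A : set K | extremal (E0 `\` A) /\ (E0 `\` A) !=set0].
have [|A [[extA A0] Amax]] := @Zorn_bigcup K P; last first.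
  exists (E0 `\` A); split=> // E' extE' E'0 E'A; apply: contrapT => E'n.
  have E'E0 : E0 `\` (~` E') = E'.
    by rewrite setDE setCK; apply/setIidPr => z /E'A[].
  apply: (Amax (~` E')); last by split; rewrite E'E0.
  split=> [z Az E'z|E'cA]; first by have [] := E'A _ E'z.
  apply: E'n; apply/seteqP; split=> // z [E0z nAz].
  by apply: contrapT => nE'z; apply: nAz; exact: E'cA.
move=> F FP Ftot; split.
  (* The index [None] stands for [E0], so that the empty chain is covered. *)
  pose J := option (set K).
  pose D : set J := [set j | if j is Some A then F A else True].
  pose E (j : J) := if j is Some A then E0 `\` A else E0.
  have -> : E0 `\` \bigcup_(X in F) X = \bigcap_(j in D) E j.
    apply/seteqP; split=> [z [E0z Fz] [A FA|_]//|z zE].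
      by split=> // Az; apply: Fz; exists A.
    split; first exact: (zE None).
    by move=> [A FA Az]; have [_] := zE (Some A) FA.
  by apply: extremal_bigcap => -[A /FP[]|].
(* If the chain covered [E0], a single member of it would, by compactness. *)
apply: contrapT => /nonemptyPn; rewrite -subset0 => E0F.
pose Q (B : set K) := exists2 X, F X \/ X = set0 & E0 `&` B `<=` X.
suff [X FX E0X] : Q [set: K].
  have : (E0 `\` X) !=set0 by case: FX => [/FP[]//|->]; rewrite setD0.
  by move=> [z [E0z nXz]]; apply/nXz/E0X.
apply: (compact_set_ind compactT).
- by exists set0; [right|rewrite setI0].
- move=> B B' [X FX BX] [X' FX' BX'].
  have [XX'|XX'] : X `<=` X' \/ X' `<=` X.
    case: FX FX' => [FX|->] [FX'|->]; by [exact: Ftot|left|right].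
  + by exists X' => // z [E0z [Bz|Bz]]; [apply: XX'; apply: BX|apply: BX'].
  + by exists X => // z [E0z [Bz|Bz]]; [apply: BX|apply: XX'; apply: BX'].
- by move=> B B' BB' [X FX B'X]; exists X => // z [E0z /BB'?]; exact: B'X.
move=> y; have [E0y|E0y] := pselect (E0 y); last first.
  exists (~` E0); last by exists set0; [right|rewrite setICr].
  by apply: open_nbhs_nbhs; split=> //; apply: closed_openC; case: extE0.
have [X FX Xy] : exists2 X, F X & X y.
  apply: contrapT => nX; apply: (E0F y); split=> // -[X FX Xy]; apply: nX.
have [[cX _] _] := FP _ FX.
exists (~` (E0 `\` X)).
  by apply: open_nbhs_nbhs; split; [exact: closed_openC|move=> []].
exists X; first by left.
by move=> z [E0z nz]; apply: contrapT => Xz; apply: nz.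
Qed.

Lemma extremal_set1_choquet x : extremal [set x] -> choquet_boundary Phi x.
Proof.
move=> [cx xnull] mu; split=> [mux A mA|mux phi _]; last first.
  rewrite (eq_measure_integral (\d_(x : borel K))); last first.
    by move=> A mA _; exact: mux.
  rewrite integral_dirac//; last first.
    exact: measurable_int (cfun_integrable mu phi measurableT).
  by rewrite diracE in_setT mul1e.
have mu0 : mu (~` [set x]) = 0%E by exact: xnull mux.
have m1 : measurable (~` [set x] : set (borel K)).
  exact: open_borel (closed_openC cx).
have nullS (B : set (borel K)) : measurable B -> ~ B x -> mu B = 0%E.
  move=> mB Bx; apply: (subset_measure0 mB m1 _ mu0) => z Bz zx.
  by apply: Bx; rewrite -zx.
rewrite diracE; have [/set_mem Ax|/negP Ax] := boolP (x \in A).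
  rewrite -[A]setCK probability_setC; last exact: measurableC.
  by rewrite nullS ?sube0//; exact: measurableC.
by rewrite nullS// => Ax'; apply: Ax; exact: mem_set.
Qed.

End trace.

(** * Common maximizers on the Choquet boundary *)

Theorem theorem35 (R : realType) (K : compactMetricType R)
  (Phi : submodClosed (cfun K))
  (Phi_closed : closed [set phi : cfun K | phi \in Phi])
  (Phi_sep : separates_points Phi)
  (Phi_cst : contains_constants Phi)
  (I : Type) (f : I -> K -> R)
  (f_trace : forall i, usc_convex_trace Phi (f i))
  (f_argmax : \bigcap_(i in [set: I]) argmax (f i) !=set0) :
  exists2 xbar : K, choquet_boundary Phi xbar & forall i, argmax (f i) xbar.
Proof.
have extmax : extremal Phi (\bigcap_(i in [set: I]) argmax (f i)).
  apply: extremal_bigcap => i _.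
  suff -> : argmax (f i) = face [set: K] (f i).
    by apply: face_extremal => //; exact: extremal_setT.
  by apply/seteqP; split=> [x xmax|x [_ xmax] y]; [split|exact: xmax].
have [E [extE [x Ex] Emax Emin]] := extremal_minimal extmax f_argmax.
exists x; last by move=> i; exact: Emax.
apply: extremal_set1_choquet; suff <- : E = [set x] by [].
apply/seteqP; split=> [y Ey|_ ->//]; apply: contrapT => /eqP yx.
have [phi Phiphi /negP] := Phi_sep _ _ yx; apply.
have [z + zmax] : exists2 z, z \in E & forall t, t \in E -> phi t <= phi z.
  apply: compact_EVT_max; first by exists x.
    by apply: (subclosed_compact _ compactT) => //; case: extE.
  by apply: continuous_subspaceT => t; exact: cfun_continuous.
move=> /set_mem Ez.
have faceE : face E phi = E.
  apply: Emin => [||t []//].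
    by apply: face_extremal => //; exact: eval_usc_convex_trace.
  by exists z; split=> // t Et; apply: zmax; exact: mem_set.
move: Ex Ey; rewrite -{1 2}faceE => -[Ex xmax] [Ey ymax].
by rewrite eq_le xmax// ymax.
Qed.
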